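(* Let $\mathcal{P}=(S,A,T,r)$ be a Markov decision process modelling the environment, let $\Sigma_{\mathcal P}=(S,U_A,F)$ be a safety-relevant model of $\mathcal P$, let $S^S_t\subseteq S$, $t=0,1,2,\ldots$, be a sequence of safe sets (the safety specification), and let $C_t$, $t=0,1,2,\ldots$, be a safety controller for $\Sigma_{\mathcal P}$ and this specification. Consider an agent that moves in $\mathcal P$ according to the SafetyFilter algorithm described in the context (with any parameters $\alpha,\gamma,\varepsilon,K,N$, any Q-table $\mathbb Q$ and any model $\mathbb M$ as inputs). If the agent's initial state satisfies $s_0\in \mathrm{Dom}(C_0)$, then the agent never violates the safety constraints: for every possible run $s_0,s_1,s_2,\ldots$ of the agent, $s_t\in S^S_t$ for every time step $t$ reached in the run.
   Context: **MDP.** An MDP is a tuple $\mathcal P=(S,A,T,r)$, where $S$ is a finite set of states; $A(s)$ is a finite non-empty set of actions available in state $s$; $T(s,a,s')=\Pr(s_{t+1}=s'\mid s_t=s,a_t=a)$ is the transition function; and $r(s,a,s')$ is the immediate reward. $T$ is partial: if a transition $(s,a,s')$ is impossible in the structure of the environment, $T(s,a,s')$ is undefined, written $(s,a,s')\notin T$. This differs from $T(s,a,s')=0$, which means that the transition may still occur. Thus whenever action $a\in A(s)$ is executed in state $s$, the next state $s'$ satisfies $(s,a,s')\in T$. **Safety-relevant model.** A safety-relevant model of $\mathcal P$ is a transition system $\Sigma_{\mathcal P}=(S,U_A,F)$ with the same state set, an input set $U_A$ with $\bigcup_{s\in S}A(s)\subseteq U_A$, and a transition relation $F\subseteq S\times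 U_A\times S$ such that $(s,a,s')\in F$ iff $(s,a,s')\in T$. Write $F(s,a)=\{s'\in S\mid (s,a,s')\in F\}$ and $\mathrm{Enab}_F(s)=\{a\in U_A\mid F(s,a)\neq\emptyset\}$. Set $\mathrm{Reach}(s,1)=\bigcup_{a\in A(s)}F(s,a)$, $\mathrm{Reach}(X,1)=\bigcup_{s\in X}\mathrm{Reach}(s,1)$ for $X\subseteq S$, $\mathrm{Reach}(s,n)=\mathrm{Reach}(\mathrm{Reach}(s,n-1),1)$, and $\overline{\mathrm{Reach}}(s,n)=\bigcup_{i=1}^n\mathrm{Reach}(s,i)$. **Safety controller.** A controller is a family of maps $C_t:S\to 2^{U_A}$, $t=0,1,2,\ldots$, with $C_t(s)\subseteq\mathrm{Enab}_F(s)$ for all $s\in S$. Its domain is $\mathrm{Dom}(C_t)=\{s\in S\mid C_t(s)\ne\emptyset\}$. It is a safety controller for $\Sigma_{\mathcal P}$ and the specification $(S^S_t)_{t\ge0}$ if (1) $\mathrm{Dom}(C_t)\subseteq S^S_t$ for all $t$; and (2) for all $t$, all $s\in\mathrm{Dom}(C_t)$ and all $u\in C_t(s)$, $F(s,u)\subseteq\mathrm{Dom}(C_{t+1})$. **Safe action.** For a state $s$ and proposed action $a\in A(s)$, $a_t^{safe}(s,a)=a$ if $F(s,a)\subseteq\mathrm{Dom}(C_{t+1})$, and otherwise $a_t^{safe}(s,a)$ is some element $u\in C_t(s)$. **Verified safe for $N$ steps.** For a policy $\pi$, let $\mathrm{Enab}_\pi(s)\subseteq A(s)$ be the set of actions the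 agent following $\pi$ may take in $s$ (possibly with probability zero). At time $t$ in state $s_t$, $\mathrm{isVerifiedSafe}(\pi,N)$ is computed by setting $S_t=\{s_t\}$ and $S_{i+1}=\bigcup_{s\in S_i}\bigcup_{a\in\mathrm{Enab}_\pi(s)}F(s,a)$ for $i=t,\ldots,t+N$. It returns true iff $S_{i+1}\subseteq\mathrm{Dom}(C_{i+1})$ for all $i=t,\ldots,t+N$. **SafetyFilter$(\alpha,\gamma,\varepsilon,K,N)$.** Inputs: a Q-table $\mathbb Q$ (real-valued function of state-action pairs), a model $\mathbb M$ (for a pair $(s,a)$, $\mathbb M(s,a)$ returns a reward and next state $(r',s')$, or is empty), and an initial state $s_0$. Start at $t=0$ and, while $s_t$ is not terminal, repeat: 1. If the greedy policy of $\mathbb Q$ (which in each state $s$ picks an action of $A(s)$ maximizing $\mathbb Q(s,\cdot)$) is verified safe for $N$ steps at $s_t$, let $a$ be the greedy action at $s_t$. 2. Otherwise, create a local copy $\mathbb Q_W$ of $\mathbb Q$ on all states $s'\in\overline{\mathrm{Reach}}(s_t,N+1)$ (elsewhere, read $\mathbb Q_W$ as $\mathbb Q$). Then $K$ times: randomly sample from $\mathbb M$ a pair $(s',a')$ with $s'\in\overline{\mathrm{Reach}}(s_t,N)$; if $\mathbb M(s',a_t^{safe}(s',a'))$ is defined and non-empty, take $(r',s'')$ from it and perform the Q-learning update $\mathbb Q_W(s',a')\leftarrow\mathbb Q_W(s',a')+\alpha[r'+\gamma\max_{b}\mathbb Q_W(s'',b)-\mathbb Q_W(s',a')]$. Finally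 let $a\in A(s_t)$ be chosen by the $\varepsilon$-greedy policy with respect to $\mathbb Q_W$ at $s_t$. 3. Execute the action $a_t^{safe}(s_t,a)$ in the environment $\mathcal P$, obtaining the next state $s_{t+1}$ and reward $r$; set $\mathbb M(s_t,a_t^{safe}(s_t,a))\leftarrow(r,s_{t+1})$ and $t\leftarrow t+1$. *)

(* Defs.v *)
From mathcomp Require Import all_boot all_order all_algebra finmap.
From mathcomp Require Import boolp classical_sets reals.

Set Implicit Arguments.
Unset Strict Implicit.
Unset Printing Implicit Defensive.

Import Order.TTheory GRing.Theory Num.Theory.

Local Open Scope classical_set_scope.
Local Open Scope ring_scope.

(* [Act] is a universe of action names.  [T s a s' = None] means that T is
   undefined at (s, a, s'); [Some 0] is a transition that may still occur. *)
Record mdp (R : realType) (S : finType) (Act : choiceType) := Mdp {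
  avail : S -> {fset Act};
  T : S -> Act -> S -> option R;
  rew : S -> Act -> S -> R;
  avail_neq0 : forall s, avail s != fset0;
  T_avail : forall s a s', T s a s' -> a \in avail s;
  T_ge0 : forall s a s' p, T s a s' = Some p -> 0 <= p;
  T_sum1 : forall s a, a \in avail s -> \sum_s' odflt 0 (T s a s') = 1
}.

Definition possible (R : realType) (S : finType) (Act : choiceType)
  (P : mdp R S Act) (s : S) (a : Act) (s' : S) : Prop := isSome (T P s a s').

Record safety_model (R : realType) (S : finType) (Act : choiceType)
    (P : mdp R S Act) := SafetyModel {
  UA : set Act;
  F : set (S * Act * S);
  avail_UA : \bigcup_s [set` avail P s] `<=` UA;
  F_UA : forall s a s', F (s, a, s') -> UA a;
  F_possible : forall s a s', F (s, a, s') <-> possible P s a s'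
}.

Section Model.
Variables (R : realType) (S : finType) (Act : choiceType).
Variables (P : mdp R S Act) (Sigma : safety_model P).

Definition succ (s : S) (a : Act) : set S := [set s' | F Sigma (s, a, s')].

Definition enab (s : S) : set Act := [set a | UA Sigma a /\ succ s a !=set0].

Definition reach1 (X : set S) : set S :=
  \bigcup_(s in X) \bigcup_(a in [set` avail P s]) succ s a.

(* Reach(s, n), used for n >= 1 only *)
Definition reach (s : S) (n : nat) : set S := iter n reach1 [set s].

Definition reach_upto (s : S) (n : nat) : set S :=
  \bigcup_(i in [set i | (1 <= i <= n)%N]) reach s i.

Definition controller : Type := nat -> S -> set Act.

Definition is_controller (C : controller) : Prop :=
  forall t s, C t s `<=` enab s.

Definition dom (C : controller) (t : nat) : set S := [set s | C t s !=set0].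

Definition safety_controller (SS : nat -> set S) (C : controller) : Prop :=
  [/\ is_controller C,
      forall t, dom C t `<=` SS t
    & forall t s u, dom C t s -> C t s u -> succ s u `<=` dom C t.+1].

(* [u] is a possible value of a_t^safe(s, a).  There is none when
   F(s, a) is not included in Dom(C_{t+1}) and C_t(s) is empty. *)
Definition safe_action (C : controller) (t : nat) (s : S) (a u : Act) : Prop :=
  (succ s a `<=` dom C t.+1 /\ u = a) \/
  (~ (succ s a `<=` dom C t.+1) /\ C t s u).

(* A policy is given by s |-> Enab_pi(s). *)
Definition policy : Type := S -> set Act.

Fixpoint policy_reach (pi : policy) (s : S) (k : nat) : set S :=
  if k is k'.+1 then
    \bigcup_(x in policy_reach pi s k') \bigcup_(a in pi x) succ x a
  else [set s].

(* The set S_{t+k} of the computation started at time t in state s is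
   [policy_reach pi s k]. *)
Definition is_verified_safe (C : controller) (pi : policy) (N t : nat) (s : S)
    : Prop :=
  forall k, (k <= N)%N -> policy_reach pi s k.+1 `<=` dom C (t + k).+1.

Definition qtable : Type := S -> Act -> R.

Definition maximizer (Q : qtable) (s : S) (a : Act) : Prop :=
  a \in avail P s /\ forall b, b \in avail P s -> Q s b <= Q s a.

(* The sets [pi s] are singletons when the greedy policy breaks ties
   deterministically. *)
Definition is_greedy (Q : qtable) (pi : policy) : Prop :=
  forall s, pi s !=set0 /\ pi s `<=` maximizer Q s.

(* The actions that eps-greedy may choose: exploration has probability eps,
   exploitation has probability 1 - eps. *)
Definition eps_greedy (eps : R) (Q : qtable) (s : S) : set Act :=
  [set a | (0 < eps /\ a \in avail P s) \/ (eps < 1 /\ maximizer Q s a)].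

(* [None] is an empty entry of the model. *)
Definition model : Type := S -> Act -> option (R * S).

Definition set_entry (V : Type) (f : S -> Act -> V) (s : S) (a : Act) (v : V)
    : S -> Act -> V :=
  fun s' a' => if (s' == s) && (a' == a) then v else f s' a'.

(* A local copy stores values only for the copied states; [read_copy]
   falls back on Q elsewhere. *)
Definition local_copy (X : set S) (Q : qtable) : S -> Act -> option R :=
  fun s a => if `[< X s >] then Some (Q s a) else None.

Definition read_copy (Q : qtable) (W : S -> Act -> option R) : qtable :=
  fun s a => odflt (Q s a) (W s a).

Record parameters := MkParameters {
  alpha : R;
  gamma : R;
  epsilon : R;
  nb_updates : nat; (* K *)
  horizon : nat     (* N *)
}.

Variables (C : controller) (par : parameters) (Q : qtable).

(* (s, a) can be sampled from M when the agent is in state st *)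
Definition samplable (st : S) (M : model) (s : S) (a : Act) : Prop :=
  [/\ reach_upto st (horizon par) s, a \in avail P s & M s a <> None].

(* One of the K rounds of planning at time t in state st, which turns the
   local copy W into the last argument.  It changes nothing if
   a_t^safe(s, a) is undefined, if M has no entry for it, or if there is no
   pair to sample. *)
Inductive planning_round (t : nat) (st : S) (M : model)
    (W : S -> Act -> option R) : (S -> Act -> option R) -> Prop :=
| round_update s a u r s' b :
    samplable st M s a -> safe_action C t s a u -> M s u = Some (r, s') ->
    maximizer (read_copy Q W) s' b ->
    planning_round t st M W
      (set_entry W s a (Some (read_copy Q W s a +
         alpha par * (r + gamma par * read_copy Q W s' b
                      - read_copy Q W s a))))
| round_empty s a u :
    samplable st M s a -> safe_action C t s a u -> M s u = None ->
    planning_round t st M W W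
| round_undefined s a :
    samplable st M s a -> (forall u, ~ safe_action C t s a u) ->
    planning_round t st M W W
| round_no_sample :
    (forall s a, ~ samplable st M s a) -> planning_round t st M W W.

Inductive planning (t : nat) (st : S) (M : model) :
    nat -> (S -> Act -> option R) -> (S -> Act -> option R) -> Prop :=
| planning0 W : planning t st M 0 W W
| planningS k W W' W'' :
    planning_round t st M W W' -> planning t st M k W' W'' ->
    planning t st M k.+1 W W''.

(* [pi] is the greedy policy of Q. *)
Variables (pi : policy) (terminal : set S).

Inductive proposed_action (t : nat) (st : S) (M : model) : Act -> Prop :=
| proposed_greedy a :
    is_verified_safe C pi (horizon par) t st -> pi st a ->
    proposed_action t st M a
| proposed_planned W a :
    ~ is_verified_safe C pi (horizon par) t st ->
    planning t st M (nb_updates par)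
      (local_copy (reach_upto st (horizon par).+1) Q) W ->
    eps_greedy (epsilon par) (read_copy Q W) st a ->
    proposed_action t st M a.

Definition filter_step (t : nat) (st : S) (M : model) (st' : S) (M' : model)
    : Prop :=
  exists a u, [/\ proposed_action t st M a, safe_action C t st a u,
    possible P st u st' & M' = set_entry M st u (Some (rew P st u st', st'))].

(* The states [s 0], ..., [s n] and models [m 0], ..., [m n] are those of the
   first n iterations of a run from s0 and M0; later values are irrelevant.
   The initial segments of a finite or infinite run are all of this form. *)
Definition is_run (M0 : model) (s0 : S) (n : nat) (s : nat -> S)
    (m : nat -> model) : Prop :=
  [/\ s 0%N = s0, m 0%N = M0
    & forall t, (t < n)%N ->
        ~ terminal (s t) /\ filter_step t (s t) (m t) (s t.+1) (m t.+1)].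

End Model.

(* Main.v *)
(** The states of a run never leave the domains of the controller.  An executed
    action that passed the safety test has all its successors in the next domain
    by that test; a replacement action has them by condition (2) of a safety
    controller.  How the action was proposed is irrelevant. *)
Require Import Defs.
From mathcomp Require Import all_boot all_order all_algebra finmap.
From mathcomp Require Import boolp classical_sets reals.

Local Open Scope classical_set_scope.
Local Open Scope ring_scope.

Set Implicit Arguments.
Unset Strict Implicit.

Lemma succ_safe_action (R : realType) (S : finType) (Act : choiceType)
    (P : mdp R S Act) (Sigma : safety_model P) (SS : nat -> set S)
    (C : controller S Act) (t : nat) (s : S) (a u : Act) :
  safety_controller Sigma SS C -> dom C t s ->
  safe_action Sigma C t s a u -> succ Sigma s u `<=` dom C t.+1.
Proof.
move=> [_ _ invC] domCs [[sub ->] //|[_ Cu]].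
exact: invC Cu.
Qed.

Lemma filter_step_dom (R : realType) (S : finType) (Act : choiceType)
    (P : mdp R S Act) (Sigma : safety_model P) (SS : nat -> set S)
    (C : controller S Act) (par : parameters R) (Q : qtable R S Act)
    (pi : policy S Act) (t : nat) (s s' : S) (M M' : model R S Act) :
  safety_controller Sigma SS C -> dom C t s ->
  filter_step Sigma C par Q pi t s M s' M' -> dom C t.+1 s'.
Proof.
move=> safeC domCs [a [u [_ safe_u Pu _]]].
(* The environment moves along [possible P] while the controller constrains [F Sigma]; [F_possible]
   identifies the two, so the observed [s'] lies in [succ Sigma s u]. *)
by apply: (succ_safe_action safeC domCs safe_u); apply/F_possible.
Qed.

Unset Implicit Arguments.

Theorem theoremV1 (R : realType) (S : finType) (Act : choiceType)
    (P : mdp R S Act) (Sigma : safety_model P) (SS : nat -> set S)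
    (C : controller S Act) (par : parameters R) (Q : qtable R S Act)
    (pi : policy S Act) (terminal : set S) (M0 : model R S Act) (s0 : S) :
  safety_controller Sigma SS C ->
  is_greedy P Q pi ->
  dom C 0 s0 ->
  forall (n : nat) (s : nat -> S) (m : nat -> model R S Act),
    is_run Sigma C par Q pi terminal M0 s0 n s m ->
    forall t, (t <= n)%N -> SS t (s t).
Proof.
move=> safeC _ dom0 n s m [s0E _ step] t.
have [_ domSS _] := safeC.
(* A step need not preserve membership in [SS t], so the goal is strengthened to [dom C t (s t)]
   before the induction. *)
move=> le_tn; apply: domSS.
(* In the successor case the bound [t.+1 <= n] is by definition [t < n], which is what [step] asks
   for. *)
elim: t le_tn => [|t IHt] lt_tn; first by rewrite s0E.
have [_ stept] := step t lt_tn.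
exact: filter_step_dom safeC (IHt (ltnW lt_tn)) stept.
Qed.
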